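(* Let $I=(n,m,X_1,\ldots,X_m,\tau_0)$ be an instance such that each $X_j$ is of the form $\{k_j,k_j+1\}$ with $k_j\in[n-1]$, and suppose there exist $\tau_1,\ldots,\tau_m\in\mathcal{S}_n$ with $\tau_m=\mathrm{id}$ and $\tau_{j-1}\xrightarrow{X_j}\tau_j$ for all $j\in[m]$ (i.e., $I$ is a YES-instance of V2-WPPSG$_0[2]$). Then the sorting strategy is successful on $I$, i.e., the permutation $\tau_m$ it produces equals $\mathrm{id}=(1,\ldots,n)$.
   Context: $[n]=\{1,\ldots,n\}$; $\mathcal{S}_n$ is the symmetric group on $[n]$, the image of $i$ under $\tau$ is $i\tau$, and $\tau$ is identified with the tuple $(1\tau,\ldots,n\tau)$. For $X\subseteq[n]$, $\tau'\xrightarrow{X}\tau$ means $i\tau=i\tau'$ for all $i\in[n]\setminus X$. A permutation $\tau$ is $X$-sorted if $i\tau<j\tau$ for all $i<j$ in $X$; each $\xrightarrow{X}$-class contains exactly one $X$-sorted permutation. The sorting strategy applied to $\tau_0$ and $X_1,\ldots,X_m$ defines, for $j=1,\ldots,m$, $\tau_j$ as the unique $X_j$-sorted permutation that coincides with $\tau_{j-1}$ outside $X_j$; it is successful if the final $\tau_m$ is the identity. *)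

(* Defs.v *)
From mathcomp Require Import all_boot all_fingroup.
From mathcomp Require Import zify.

Set Implicit Arguments.
Unset Strict Implicit.
Unset Printing Implicit Defensive.

(* [n] is rendered as 'I_n = {0, ..., n-1}, and the image of i under t is     *)
(* [t i]; the identity is [1%g : 'S_n].                                       *)

Section Sorting.
Variable n : nat.
Implicit Types (X : {set 'I_n}) (s t u : 'S_n).

Definition coincide_outside X s t : bool := [forall i in ~: X, t i == s i].

Definition sorted_on X t : bool :=
  [forall i in X, forall j in X, (i < j) ==> (t i < t j)].

(* The default value [t] is never used: see [sort_on_spec], [sort_on_uniq].   *)
Definition sort_on X t : 'S_n :=
  odflt t [pick u | coincide_outside X t u && sorted_on X u].

Definition sorting_strategy t0 (Xs : seq {set 'I_n}) : 'S_n :=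
  foldl (fun t X => sort_on X t) t0 Xs.

(* [taus] lists t_1, ..., t_m, so that t_(j-1) is item j-1 of t_0 :: taus.    *)
Definition yes_instance m (Xs : m.-tuple {set 'I_n}) t0 : Prop :=
  exists taus : m.-tuple 'S_n,
    last t0 taus = 1%g /\
    (forall j : 'I_m,
        coincide_outside (tnth Xs j) (nth t0 (t0 :: taus) j) (tnth taus j)).

Lemma coincide_outsideP X s t :
  reflect (forall i, i \notin X -> t i = s i) (coincide_outside X s t).
Proof.
apply: (iffP 'forall_implyP) => H i Xi; first by apply/eqP/H; rewrite inE.
by apply/eqP/H; rewrite inE in Xi.
Qed.

Lemma sorted_onP X t :
  reflect {in X &, forall i j : 'I_n, i < j -> t i < t j} (sorted_on X t).
Proof.
apply: (iffP 'forall_implyP) => H.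
  by move=> i j Xi Xj; have /forall_inP/(_ j Xj)/implyP := H i Xi.
by move=> i Xi; apply/forall_inP => j Xj; apply/implyP; apply: H.
Qed.

Lemma sort_on_ex X t : exists u, coincide_outside X t u && sorted_on X u.
Proof.
have Ht : coincide_outside X t t by apply/coincide_outsideP.
case: (arg_maxnP (fun u : 'S_n => \sum_(i : 'I_n) i * u i) Ht) => u Hu maxu.
exists u; rewrite Hu; apply/sorted_onP => i j Xi Xj lt_ij.
rewrite ltnNge leq_eqVlt; apply/negP => /orP[/eqP/val_inj/perm_inj eq_ji|lt_u].
  by rewrite eq_ji ltnn in lt_ij.
have neq_ji : j != i by apply/eqP => eq_ji; rewrite eq_ji ltnn in lt_ij.
pose v := (tperm i j * u)%g.
have Hv : coincide_outside X t v.
  apply/coincide_outsideP => k Xk; rewrite permM tpermD.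
  - by move/coincide_outsideP: Hu; apply.
  - by apply: contraNneq Xk => <-.
  - by apply: contraNneq Xk => <-.
have := maxu v Hv; rewrite /= leqNgt => /negP; apply.
rewrite (bigD1 i) //= (bigD1 j) //= [X in _ < X](bigD1 i) //=.
rewrite [X in _ < _ + X](bigD1 j) //= !permM tpermL tpermR !addnA.
rewrite [X in _ < _ + X](eq_bigr (fun k : 'I_n => k * u k)); last first.
  by move=> k /andP[ki kj]; rewrite permM tpermD // eq_sym.
rewrite ltn_add2r.
move: (val i) (val j) (val (u i)) (val (u j)) lt_ij lt_u => /=.
by move=> a b c d ab dc; nia.
Qed.

Lemma sort_on_spec X t :
  coincide_outside X t (sort_on X t) && sorted_on X (sort_on X t).
Proof.
rewrite /sort_on; case: pickP => [//|H].
by have [u] := sort_on_ex X t; rewrite H.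
Qed.

Lemma sorted_coincide_eq X s t : coincide_outside X s t ->
  sorted_on X s -> sorted_on X t -> s = t.
Proof.
move=> /coincide_outsideP Hst /sorted_onP Hs /sorted_onP Ht.
have memX (u v : 'S_n) k : (forall i, i \notin X -> v i = u i) -> k \in X ->
    (v^-1)%g (u k) \in X.
  move=> Huv Xk; apply: contraLR (Xk) => Xl.
  by have := Huv _ Xl; rewrite permKV => /perm_inj ->.
have Hts i : i \notin X -> s i = t i by move=> /Hst ->.
suff eqX m : forall i : 'I_n, i < m -> i \in X -> s i = t i.
  apply/permP => i; case: (boolP (i \in X)) => [Xi|/Hst //].
  exact: (eqX n).
elim: m => [//|m IHm] i; rewrite ltnS leq_eqVlt => /orP[/eqP im|]; last first.
  by move=> im Xi; apply: IHm.
move=> Xi.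
have key (u v : 'S_n) : (forall k, k \notin X -> v k = u k) ->
    {in X &, forall a b : 'I_n, a < b -> v a < v b} ->
    (forall k : 'I_n, k < m -> k \in X -> u k = v k) -> v i <= u i.
  move=> Huv Hv IH; have Xl := memX u v i Huv Xi.
  set l := (v^-1)%g (u i) in Xl; have vl : v l = u i by rewrite permKV.
  case: (ltngtP i l) => [il|li|/val_inj il].
  - by rewrite -vl ltnW // Hv.
  - move: (IH l); rewrite -im => /(_ li Xl); rewrite vl => /perm_inj eq_li.
    by rewrite eq_li ltnn in li.
  - by rewrite -vl -il.
apply/val_inj/eqP; rewrite eqn_leq.
apply/andP; split; first by apply: key => // k km Xk; rewrite IHm.
by apply: key => // k km Xk; rewrite IHm.
Qed.

Lemma sort_on_uniq X t u :
  coincide_outside X t u -> sorted_on X u -> u = sort_on X t.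
Proof.
move=> /coincide_outsideP Hu Su.
have /andP[/coincide_outsideP Hs Ss] := sort_on_spec X t.
apply: (@sorted_coincide_eq X) => //.
by apply/coincide_outsideP => i Xi; rewrite Hu ?Hs.
Qed.

End Sorting.

(* Main.v *)
Require Import Defs.
From mathcomp Require Import all_boot all_fingroup.
From mathcomp Require Import zify.

(** The sorting strategy stays below every other play in the Bruhat order,
    which is described by the rank matrix [prefix_count s a b], the number of
    positions [i < a] with [s i < b]: [s] is below [t] when its rank matrix
    dominates that of [t].  A step on the positions [k, k+1] changes only the
    row [a = k+1] of the rank matrix, and always
    [prefix_count s k.+1 b <= minn (prefix_count s k b).+1 (prefix_count s k.+2 b)],
    with equality when [s] is sorted on [k, k+1].  This bound is monotone in
    the two unchanged rows, so sorting preserves domination whatever the other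
    play does.  Only the identity is below the identity. *)

Set Implicit Arguments.
Unset Strict Implicit.
Unset Printing Implicit Defensive.

Section PrefixCount.
Variable n : nat.
Implicit Types (X : {set 'I_n}) (s t : 'S_n) (i k : 'I_n).

Definition prefix_count s (a b : nat) : nat := \sum_(i < n | i < a) (s i < b).

Definition bruhat_le s t : Prop :=
  forall a b, prefix_count t a b <= prefix_count s a b.

Definition adjacent_pair X : Prop :=
  exists k k' : 'I_n, k' = k.+1 :> nat /\ X = [set k; k'].

Lemma prefix_countS s k b :
  prefix_count s k.+1 b = prefix_count s k b + (s k < b).
Proof.
rewrite /prefix_count (bigD1 k) //= addnC; congr (_ + _).
by apply: eq_bigl => i; rewrite -(inj_eq val_inj) /=; lia.
Qed.

Lemma sum_perm_lt s b : \sum_(i < n) (s i < b) = \sum_(i < n) (i < b).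
Proof. by rewrite [RHS](reindex_inj (@perm_inj _ s)). Qed.

Lemma prefix_count_compl s a b :
  prefix_count s a b + \sum_(i < n | a <= i) (s i < b) = \sum_(i < n) (i < b).
Proof.
rewrite -(sum_perm_lt s) [RHS](bigID (fun i : 'I_n => i < a)) /=; congr (_ + _).
by apply: eq_bigl => i; rewrite -leqNgt.
Qed.

(** If [X] lies before [a], the positions from [a] on are untouched, and the total over all
    positions is the same for every permutation. *)
Lemma prefix_count_coincide X s t a b : coincide_outside X s t ->
  (forall i, i \in X -> a <= i) \/ (forall i, i \in X -> i < a) ->
  prefix_count t a b = prefix_count s a b.
Proof.
move=> /coincide_outsideP st [geX|ltX].
  apply: eq_bigr => i ia; rewrite st //.
  by apply/negP => /geX; rewrite leqNgt ia.
apply/eqP.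
rewrite -(eqn_add2r (\sum_(i < n | a <= i) (t i < b))) prefix_count_compl.
rewrite -(prefix_count_compl s a b) eqn_add2l; apply/eqP.
apply: eq_bigr => i ai; rewrite st //.
by apply/negP => /ltX; rewrite ltnNge ai.
Qed.

Lemma prefix_count_le_min s k k' b : k' = k.+1 :> nat ->
  prefix_count s k.+1 b <=
    minn (prefix_count s k b).+1 (prefix_count s k.+2 b).
Proof. by move=> kk'; rewrite -kk' prefix_countS kk' prefix_countS; lia. Qed.

(** The bound is strict only when [s k' < b <= s k], which sortedness excludes. *)
Lemma prefix_count_sorted s k k' b : k' = k.+1 :> nat -> s k < s k' ->
  prefix_count s k.+1 b =
    minn (prefix_count s k b).+1 (prefix_count s k.+2 b).
Proof. by move=> kk' ss; rewrite -kk' prefix_countS kk' prefix_countS; lia. Qed.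

Lemma bruhat_le_sort_on X s t t' : adjacent_pair X -> bruhat_le s t ->
  coincide_outside X t t' -> bruhat_le (sort_on X s) t'.
Proof.
move=> [k [k' [kk' XE]]] st tt' a b.
have /andP[su /sorted_onP sortu] := sort_on_spec X s.
have unchanged c : c != k.+1 ->
    prefix_count t' c b <= prefix_count (sort_on X s) c b.
  move=> ck; have cX : (forall i, i \in X -> c <= i) \/
                       (forall i, i \in X -> i < c).
    case: (leqP c k) => [le_ck|lt_kc]; [left|right] => i;
      by rewrite XE !inE => /orP[] /eqP ->; lia.
  by rewrite (prefix_count_coincide b su cX) (prefix_count_coincide b tt' cX).
case: (eqVneq a k.+1) => [->|/unchanged //].
have sorted_k : sort_on X s k < sort_on X s k'.
  by apply: sortu; rewrite ?XE ?inE ?eqxx ?orbT ?kk'.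
rewrite (prefix_count_sorted b kk' sorted_k).
have := prefix_count_le_min t' b kk'.
have := unchanged k; have := unchanged k.+2; lia.
Qed.

Lemma bruhat_le1 s : bruhat_le s 1%g -> s = 1%g.
Proof.
move=> s_le1.
(* At row and column [i.+1] the identity counts every position of the prefix, so [s] must too,
   position [i] included. *)
have s_le i : s i <= i.
  have := s_le1 i.+1 i.+1; rewrite !prefix_countS perm1 ltnSn.
  suff : prefix_count s i i.+1 <= prefix_count 1 i i.+1.
    by rewrite -[s i <= i]/(s i < i.+1); case: (s i < i.+1) => //=; lia.
  apply: leq_sum => j ji; rewrite perm1.
  by rewrite [j < i.+1]ltnW //; case: (_ < _).
suff fix_lt c i : i < c -> s i = i.
  by apply/permP => i; rewrite perm1 (fix_lt n).
elim: c i => // c IHc i ic; apply/val_inj/eqP; rewrite eqn_leq s_le /= leqNgt.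
(* By induction the smaller value [s i] is a fixed point, so injectivity forces [s i = i]. *)
apply/negP => lt_si; have /perm_inj si : s (s i) = s i.
  by apply: IHc; apply: leq_trans lt_si _.
by rewrite si ltnn in lt_si.
Qed.

Lemma bruhat_le_sorting_strategy (Xs : seq {set 'I_n}) (taus : seq 'S_n) s t :
  size taus = size Xs ->
  (forall j, j < size Xs -> adjacent_pair (nth set0 Xs j)) ->
  (forall j, j < size Xs -> coincide_outside (nth set0 Xs j)
     (nth 1%g (t :: taus) j) (nth 1%g taus j)) ->
  bruhat_le s t -> bruhat_le (sorting_strategy s Xs) (last t taus).
Proof.
elim: Xs taus s t => [|X Xs IH] [|t' taus] s t //= [sz] adj step st.
apply: IH => // [j|j|]; [exact: (adj j.+1) | exact: (step j.+1) |].
by apply: bruhat_le_sort_on (adj 0 _) st (step 0 _).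
Qed.

End PrefixCount.

Theorem theorem3p8 (n m : nat) (X : m.-tuple {set 'I_n}) (tau0 : 'S_n)
    (X_adjacent : forall j : 'I_m, exists k k' : 'I_n,
        k' = k.+1 :> nat /\ tnth X j = [set k; k'])
    (I_yes : yes_instance X tau0) :
  sorting_strategy tau0 X = 1%g.
Proof.
have [taus [last1 step]] := I_yes.
apply: bruhat_le1; rewrite -last1.
apply: bruhat_le_sorting_strategy; rewrite ?size_tuple // => j jm.
  by have := X_adjacent (Ordinal jm); rewrite (tnth_nth set0).
have := step (Ordinal jm); rewrite (tnth_nth set0) (tnth_nth 1%g) /=.
(* The defaults [tau0] and [1%g] are interchangeable, since [j] is within the bounds of
   [tau0 :: taus]. *)
by rewrite (set_nth_default 1%g) //= size_tuple ltnS ltnW.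
Qed.
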